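(* Let $M\in[0,1]^{m\times n}$ with $\|M\|_*\le t$, let $\rho\in[0,1)$ and $\delta\in(0,1)$. Let $Y\in\{0,1\}^{m\times n}$ have independent entries with $P(Y_{ij}=1)=M_{ij}$, and let $A\in\{0,1\}^{m\times n}$ be obtained by revealing each 1 of $Y$ independently with probability $1-\rho$ (so $P(A_{ij}=1)=M_{ij}(1-\rho)$, and $A_{ij}=0$ otherwise). Let $F_u\in\mathbb{R}^{m\times d}$ and $F_v\in\mathbb{R}^{n\times d}$ have orthonormal columns, with rows ${\boldsymbol u}_i$ ($i=1,\dots,m$) and ${\boldsymbol v}_j$ ($j=1,\dots,n$), and set $\mathcal{X}_u=\max_i\|{\boldsymbol u}_i\|$, $\mathcal{X}_v=\max_j\|{\boldsymbol v}_j\|$. Assume $M=F_uF_u^TMF_vF_v^T$. Define $$\tilde{\ell}(x,a)=\begin{cases}\dfrac{(x-1)^2-\rho x^2}{1-\rho} & \text{if } a=1,\\[1mm] x^2 & \text{if } a=0,\end{cases}$$ and let $\hat{D}$ be an optimal solution of $$\min_{D\in\mathbb{R}^{d\times d}}\sum_{i,j}\tilde{\ell}\big((F_uDF_v^T)_{ij},A_{ij}\big)\quad\text{subject to}\quad\|D\|_*\le t,\ 0\le (F_uDF_v^T)_{ij}\le 1\ \forall (i,j).$$ Then, with probability at least $1-\delta$, $$\frac{1}{mn}\sum_{i,j}\big(M_{ij}-(F_u\hat{D}F_v^T)_{ij}\big)^2\le 6\,\frac{\sqrt{\log(2/\delta)}}{\sqrt{mn}\,(1-\rho)}+\frac{4t\sqrt{\log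 2d}}{\sqrt{mn}\sqrt{1-\rho}}\,\mathcal{X}_u\mathcal{X}_v .$$
   Context: $\|\cdot\|_*$ is the nuclear norm. This is the inductive version of shifted matrix completion for PU learning in the non-deterministic setting, where row features $F_u$ and column features $F_v$ are given and the estimate is $F_u\hat{D}F_v^T$. *)

(* Defs.v *)
From HB Require Import structures.
From mathcomp Require Import all_boot all_order all_algebra.
From mathcomp Require Import boolp classical_sets reals exp.
Set Implicit Arguments. Unset Strict Implicit. Unset Printing Implicit Defensive.
Import Order.TTheory GRing.Theory Num.Theory.
Local Open Scope ring_scope.

Section Defs.
Variable R : realType.

Definition orthogonal_mx (k : nat) (U : 'M[R]_k) : Prop := U *m U^T = 1%:M.

Definition nonneg_rect_diag (m n : nat) (S : 'M[R]_(m, n)) : Prop :=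
  forall (i : 'I_m) (j : 'I_n),
    (nat_of_ord i != nat_of_ord j -> S i j = 0) /\ 0 <= S i j.

Definition rect_diag_sum (m n : nat) (S : 'M[R]_(m, n)) : R :=
  \sum_(i < m) \sum_(j < n | nat_of_ord i == nat_of_ord j) S i j.

Definition svd_sum (m n : nat) (A : 'M[R]_(m, n)) (x : R) : Prop :=
  exists (U : 'M[R]_m) (S : 'M[R]_(m, n)) (V : 'M[R]_n),
    [/\ orthogonal_mx U, orthogonal_mx V, nonneg_rect_diag S,
        A = U *m S *m V^T & x = rect_diag_sum S].

(* nuclear norm = sum of singular values (the set above is a singleton) *)
Definition nucnorm (m n : nat) (A : 'M[R]_(m, n)) : R :=
  sup [set x | svd_sum A x].

Definition row_norm (m d : nat) (F : 'M[R]_(m, d)) (i : 'I_m) : R :=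
  Num.sqrt (\sum_(k < d) F i k ^+ 2).

Definition max_row_norm (m d : nat) (F : 'M[R]_(m, d)) : R :=
  \big[Num.max/0]_(i < m) row_norm F i.

(* unbiased loss for PU learning *)
Definition ltilde (rho x : R) (a : bool) : R :=
  if a then ((x - 1) ^+ 2 - rho * x ^+ 2) / (1 - rho) else x ^+ 2.

Definition objective (m n d : nat) (rho : R) (Fu : 'M[R]_(m, d)) (Fv : 'M[R]_(n, d))
  (A : 'M[bool]_(m, n)) (D : 'M[R]_d) : R :=
  let X := Fu *m D *m Fv^T in \sum_(i < m) \sum_(j < n) ltilde rho (X i j) (A i j).

Definition feasible (m n d : nat) (t : R) (Fu : 'M[R]_(m, d)) (Fv : 'M[R]_(n, d))
  (D : 'M[R]_d) : Prop :=
  nucnorm D <= t /\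
  forall i j, 0 <= (Fu *m D *m Fv^T) i j <= 1.

Definition optimal (m n d : nat) (rho t : R) (Fu : 'M[R]_(m, d)) (Fv : 'M[R]_(n, d))
  (A : 'M[bool]_(m, n)) (D : 'M[R]_d) : Prop :=
  feasible t Fu Fv D /\
  forall D', feasible t Fu Fv D' -> objective rho Fu Fv A D <= objective rho Fu Fv A D'.

Definition probA (m n : nat) (rho : R) (M : 'M[R]_(m, n)) (A : 'M[bool]_(m, n)) : R :=
  \prod_(i < m) \prod_(j < n)
     (if A i j then M i j * (1 - rho) else 1 - M i j * (1 - rho)).

Definition Prob (m n : nat) (rho : R) (M : 'M[R]_(m, n)) (E : 'M[bool]_(m, n) -> Prop) : R :=
  \sum_(A : 'M[bool]_(m, n) | `[< E A >]) probA rho M A.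

Definition mse (m n : nat) (M X : 'M[R]_(m, n)) : R :=
  (m * n)%:R^-1 * \sum_(i < m) \sum_(j < n) (M i j - X i j) ^+ 2.

End Defs.

(* Main.v *)
Require Import Defs.
From HB Require Import structures.
From mathcomp Require Import all_boot all_order all_algebra.
From mathcomp Require Import boolp classical_sets reals exp.
From mathcomp Require Import sequences ring lra.
Import Order.TTheory GRing.Theory Num.Theory.
Local Open Scope ring_scope.

(* The loss is affine in the observation: ltilde x a = x^2 - a (2 x - 1) / (1 - rho). With
   Z = A / (1 - rho) - M, which is centred with independent entries, comparing an optimal
   X = Fu D Fv^T with M = Fu D0 Fv^T (D0 = Fu^T M Fv is feasible) gives
   |X - M|^2 <= 2 <X - M, Z> in Frobenius norm. Let f be the supremum of <X - M, Z> over
   feasible D. Since X and M have nonnegative entries and the nuclear norm dominates the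
   Frobenius norm, |D - D0|^2 <= 2 t^2, so f^2 <= 2 t^2 |Fu^T Z Fv|^2, whose mean is at most
   2 t^2 d^2 / (1 - rho), and d <= sqrt (m n) Xu Xv. This and ln 2 >= 1/2 bound E f by the
   second term of the estimate. A bounded differences inequality for f gives the first term;
   it needs only small exponents because the claim is trivial when the first term is >= 1. *)

(** * Frobenius inner product *)

Definition fdot {R : realType} {m n : nat} (A B : 'M[R]_(m, n)) : R := \tr (A^T *m B).

Lemma fdotE {R : realType} {m n : nat} (A B : 'M[R]_(m, n)) :
  fdot A B = \sum_i \sum_j A i j * B i j.
Proof.
rewrite /fdot /mxtrace exchange_big /=; apply: eq_bigr => j _.
by rewrite !mxE; apply: eq_bigr => i _; rewrite !mxE.
Qed.

Lemma fdotC {R : realType} {m n : nat} (A B : 'M[R]_(m, n)) : fdot A B = fdot B A.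
Proof. by rewrite /fdot -mxtrace_tr trmx_mul trmxK. Qed.

Lemma fdotDr {R : realType} {m n : nat} (A B C : 'M[R]_(m, n)) :
  fdot A (B + C) = fdot A B + fdot A C.
Proof. by rewrite /fdot mulmxDr mxtraceD. Qed.

Lemma fdotZr {R : realType} {m n : nat} a (A B : 'M[R]_(m, n)) :
  fdot A (a *: B) = a * fdot A B.
Proof. by rewrite /fdot -scalemxAr mxtraceZ. Qed.

Lemma fdot0l {R : realType} {m n : nat} (A : 'M[R]_(m, n)) : fdot 0 A = 0.
Proof. by rewrite /fdot trmx0 mul0mx mxtrace0. Qed.

Lemma fdotDl {R : realType} {m n : nat} (A B C : 'M[R]_(m, n)) :
  fdot (A + B) C = fdot A C + fdot B C.
Proof. by rewrite fdotC fdotDr !(fdotC C). Qed.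

Lemma fdotZl {R : realType} {m n : nat} a (A B : 'M[R]_(m, n)) :
  fdot (a *: A) B = a * fdot A B.
Proof. by rewrite fdotC fdotZr fdotC. Qed.

Lemma fdotBr {R : realType} {m n : nat} (A B C : 'M[R]_(m, n)) :
  fdot A (B - C) = fdot A B - fdot A C.
Proof. by rewrite -scaleN1r fdotDr fdotZr mulN1r. Qed.

Lemma fdotBl {R : realType} {m n : nat} (A B C : 'M[R]_(m, n)) :
  fdot (A - B) C = fdot A C - fdot B C.
Proof. by rewrite fdotC fdotBr !(fdotC C). Qed.

Lemma fdot_mull {R : realType} {m n p : nat} (A : 'M[R]_(m, n)) (B : 'M_(n, p)) C :
  fdot (A *m B) C = fdot B (A^T *m C).
Proof. by rewrite /fdot trmx_mul mulmxA. Qed.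

Lemma fdot_mulr {R : realType} {m n p : nat} (A : 'M[R]_(m, n)) (B : 'M_(n, p)) C :
  fdot (A *m B) C = fdot A (C *m B^T).
Proof. by rewrite /fdot trmx_mul mxtrace_mulC mulmxA mxtrace_mulC mulmxA. Qed.

Lemma fdot_ge0 {R : realType} {m n : nat} (A : 'M[R]_(m, n)) : 0 <= fdot A A.
Proof. by rewrite fdotE !sumr_ge0 // => i _; apply: sumr_ge0 => j _; rewrite -expr2 sqr_ge0. Qed.

Lemma sqr_le_fdot {R : realType} {m n : nat} (A : 'M[R]_(m, n)) i j :
  A i j ^+ 2 <= fdot A A.
Proof.
rewrite fdotE (bigD1 i) //= (bigD1 j) //= -expr2 -addrA lerDl.
rewrite addr_ge0 ?sumr_ge0 // => k _; rewrite -?expr2 ?sqr_ge0 ?sumr_ge0 // => l _.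
by rewrite -expr2 sqr_ge0.
Qed.

Lemma fdot_le0 {R : realType} {m n : nat} (A : 'M[R]_(m, n)) : fdot A A <= 0 -> A = 0.
Proof.
move=> A0; apply/matrixP => i j; rewrite mxE; apply/eqP.
by rewrite -[_ == 0]sqrf_eq0 eq_le sqr_ge0 (le_trans (sqr_le_fdot _ _ _) A0).
Qed.

(** Evaluating the form at [(b, - a)] gives [a * (a * c - b ^+ 2)]; if [a = 0], the point
    [(- (c + 1), b)] forces [b = 0]. This yields Cauchy-Schwarz both for [fdot] and for the
    semidefinite form [Q] of [top_eigenvector]. *)
Lemma psd_form_le {R : realType} (a b c : R) :
  (forall x y, 0 <= a * x ^+ 2 + 2 * b * x * y + c * y ^+ 2) -> b ^+ 2 <= a * c.
Proof.
move=> H.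
have a0 : 0 <= a by have := H 1 0; rewrite !(expr1n, expr0n, mulr0, mulr1, addr0).
have c0 : 0 <= c by have := H 0 1; rewrite !(expr1n, expr0n, mulr0, mulr1, mul0r, add0r).
have [az|an0] := eqVneq a 0.
  have := H (- (c + 1)) b; rewrite az.
  have -> : 0 * (- (c + 1)) ^+ 2 + 2 * b * - (c + 1) * b + c * b ^+ 2
    = - (b ^+ 2 * (c + 2)) by ring.
  by rewrite mul0r oppr_ge0 pmulr_lle0 // ltr_wpDl.
have := H b (- a).
have -> : a * b ^+ 2 + 2 * b * b * - a + c * (- a) ^+ 2 = a * (a * c - b ^+ 2) by ring.
by rewrite pmulr_rge0 ?subr_ge0 // lt0r an0.
Qed.

Lemma fdot_cs {R : realType} {m n : nat} (A B : 'M[R]_(m, n)) :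
  fdot A B ^+ 2 <= fdot A A * fdot B B.
Proof.
apply: psd_form_le => x y.
have := fdot_ge0 (x *: A + y *: B).
by rewrite !(fdotDl, fdotDr, fdotZl, fdotZr) (fdotC B A); congr (_ <= _); ring.
Qed.

Lemma fdot_row {R : realType} {m n : nat} (A B : 'M[R]_(m, n)) :
  fdot A B = \sum_i fdot (row i A) (row i B).
Proof.
rewrite fdotE; apply: eq_bigr => i _; rewrite fdotE big_ord1.
by apply: eq_bigr => j _; rewrite !mxE.
Qed.

(** Cauchy-Schwarz on each row: the Frobenius norm dominates the operator norm. *)
Lemma fdot_mul_le {R : realType} {m n : nat} (A : 'M[R]_(m, n)) (v : 'cV_n) :
  fdot (A *m v) (A *m v) <= fdot A A * fdot v v.
Proof.
rewrite fdotE (fdot_row A) mulr_suml; apply: ler_sum => i _; rewrite big_ord1.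
have <- : fdot (row i A) v^T = (A *m v) i 0.
  by rewrite fdotE big_ord1 mxE; apply: eq_bigr => j _; rewrite !mxE.
rewrite -expr2 (le_trans (fdot_cs _ _)) // (_ : fdot v^T v^T = fdot v v) //.
by rewrite /fdot trmxK mxtrace_mulC.
Qed.

Lemma fdot_gt0 {R : realType} {m n : nat} (A : 'M[R]_(m, n)) : A != 0 -> 0 < fdot A A.
Proof. by move=> A0; rewrite ltNge; apply: contra A0 => /fdot_le0 ->. Qed.

Lemma fdot_delta {R : realType} {m : nat} (u : 'cV[R]_m) i : fdot (delta_mx i 0) u = u i 0.
Proof.
rewrite fdotE (bigD1 i) //= big_ord1 mxE !eqxx mul1r big1 ?addr0 // => j ji.
by rewrite big_ord1 mxE (negPf ji) mul0r.
Qed.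

(** * Singular value decomposition *)

(* The supremum lam of the Rayleigh quotient of G = D^T D is attained: if lam - G were
   invertible, Cauchy-Schwarz for the form of lam - G would bound it below by a positive
   multiple of the identity. *)
Lemma top_eigenvector {R : realType} {m n : nat} (D : 'M[R]_(m, n.+1)) :
  exists2 lam, forall v : 'cV_n.+1, fdot (D *m v) (D *m v) <= lam * fdot v v &
  exists2 v : 'cV_n.+1, fdot v v = 1 & D^T *m (D *m v) = lam *: v.
Proof.
pose E := [set x | exists2 v : 'cV[R]_n.+1, fdot v v = 1 & x = fdot (D *m v) (D *m v)]%classic.
have E0 : (E !=set0)%classic.
  by eexists; exists (delta_mx 0 0); [rewrite fdot_delta mxE | reflexivity].
have bE : has_ubound E.
  by exists (fdot D D) => _ [v v1 ->]; rewrite (le_trans (fdot_mul_le _ _)) // v1 mulr1.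
pose lam := sup E; have rayleigh (v : 'cV_n.+1) : fdot (D *m v) (D *m v) <= lam * fdot v v.
  have [->|v0] := eqVneq v 0; first by rewrite mulmx0 !fdot0l mulr0.
  have vp := fdot_gt0 _ v0; have sp : 0 < Num.sqrt (fdot v v) by rewrite sqrtr_gt0.
  have s2 : Num.sqrt (fdot v v) ^+ 2 = fdot v v by rewrite sqr_sqrtr ?ltW.
  rewrite -ler_pdivrMr //; apply: ub_le_sup => //.
  exists ((Num.sqrt (fdot v v))^-1 *: v).
    by rewrite fdotZl fdotZr mulrA -expr2 exprVn s2 mulVf ?gt_eqF.
  by rewrite -scalemxAr fdotZl fdotZr mulrA -expr2 exprVn s2 mulrC.
exists lam => //.
pose Q := lam%:M - D^T *m D.
have QE (v w : 'cV_n.+1) : fdot v (Q *m w) = lam * fdot v w - fdot (D *m v) (D *m w).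
  by rewrite mulmxBl mul_scalar_mx fdotBr fdotZr fdot_mull mulmxA.
have Q_ge0 (v : 'cV_n.+1) : 0 <= fdot v (Q *m v) by rewrite QE subr_ge0.
have Q_cs (v w : 'cV_n.+1) : fdot v (Q *m w) ^+ 2 <= fdot v (Q *m v) * fdot w (Q *m w).
  apply: psd_form_le => x y; have := Q_ge0 (x *: v + y *: w).
  rewrite !QE !(mulmxDr, fdotDl, fdotDr, =^~ scalemxAr, fdotZl, fdotZr).
  by rewrite (fdotC w v) (fdotC (D *m w)); congr (_ <= _); ring.
have [Qu|] := boolP (Q \in unitmx).
  (* For a unit vector [v], the form inequality at [v] and [P *m v] reads
     [1 <= fdot v (Q *m v) * fdot (P *m v) v], whose last factor is at most [K]. Hence every
     Rayleigh quotient is at most [lam - K^-1], against the choice of [lam]. *)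
  pose P := invmx Q; pose K := fdot P P + 1.
  have Kp : 0 < K by rewrite ltr_wpDl // fdot_ge0.
  suff : lam <= lam - K^-1 by rewrite lerBrDr gerDl leNgt invr_gt0 Kp.
  apply: ge_sup => // _ [v v1 ->]; rewrite lerBrDr -lerBrDl.
  have := QE v v; rewrite v1 mulr1 => <-.
  rewrite -div1r ler_pdivrMr //.
  have := Q_cs v (P *m v); rewrite mulmxA mulmxV // mul1mx v1 expr1n => /le_trans; apply.
  rewrite ler_wpM2l //.
  have := le_trans (fdot_cs (P *m v) v) (ler_wpM2r (fdot_ge0 v) (fdot_mul_le P v)).
  by rewrite v1 !mulr1 /K; have := fdot_ge0 P; nra.
(* A singular [Q] has a left kernel vector, which symmetry turns into a right one; normalized, it is
   the eigenvector. *)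
rewrite unitmxE unitfE negbK => /det0P [w w0 wQ].
have Qw : Q *m w^T = 0.
  apply: trmx_inj; rewrite trmx_mul trmxK trmx0 -[RHS]wQ; congr (_ *m _).
  by rewrite linearB /= tr_scalar_mx trmx_mul trmxK.
have wT0 : w^T != 0 by apply: contraNneq w0 => /(congr1 trmx); rewrite trmxK trmx0 => ->.
have vp := fdot_gt0 _ wT0.
have s2 : Num.sqrt (fdot w^T w^T) ^+ 2 = fdot w^T w^T by rewrite sqr_sqrtr ?ltW.
exists ((Num.sqrt (fdot w^T w^T))^-1 *: w^T).
  by rewrite fdotZl fdotZr mulrA -expr2 exprVn s2 mulVf ?gt_eqF.
rewrite -!scalemxAr scalerA mulrC -scalerA; congr (_ *: _).
by apply/esym/eqP; rewrite -subr_eq0 mulmxA -mul_scalar_mx -mulmxBl Qw.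
Qed.

(** Take [s = Num.sqrt lam] and [u = s^-1 *: (D *m v)] for the top eigenpair of [D^T *m D];
    [lam <= 0] would annihilate every column of [D]. *)
Lemma top_singular {R : realType} {m n : nat} (D : 'M[R]_(m, n.+1)) : D != 0 ->
  exists (s : R) (u : 'cV_m) (v : 'cV_n.+1),
    [/\ 0 < s, fdot u u = 1, fdot v v = 1, D *m v = s *: u & D^T *m u = s *: v].
Proof.
move=> D0; have [lam Dlam [v v1 Dv]] := top_eigenvector D.
have lam_gt0 : 0 < lam.
  rewrite ltNge; apply: contra D0 => lam0; apply/eqP/matrixP => i j.
  have /fdot_le0 Dj : fdot (D *m delta_mx j 0 : 'cV_m) (D *m delta_mx j 0) <= 0.
    by rewrite (le_trans (Dlam _)) // mulr_le0_ge0 // fdot_ge0.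
  by have /matrixP/(_ i 0) := Dj; rewrite -colE !mxE.
have s_gt0 : 0 < Num.sqrt lam by rewrite sqrtr_gt0.
have s2 : Num.sqrt lam ^+ 2 = lam by rewrite sqr_sqrtr ?ltW.
exists (Num.sqrt lam), ((Num.sqrt lam)^-1 *: (D *m v)), v; split => //.
- by rewrite fdotZl fdotZr fdot_mull Dv fdotZr v1 mulr1 mulrA -expr2 exprVn s2 mulVf ?gt_eqF.
- by rewrite scalerA mulfV ?scale1r ?gt_eqF.
- by rewrite -scalemxAr Dv scalerA -[X in _ * X]s2 expr2 mulrA mulVf ?mul1r ?gt_eqF.
Qed.

(** The reflection in the hyperplane orthogonal to [w = u - e] swaps the unit vectors [e] and [u];
    if [u = e] the identity serves. *)
Lemma householder {R : realType} {n : nat} (u : 'cV[R]_n.+1) : fdot u u = 1 ->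
  exists2 H : 'M[R]_n.+1, H *m H^T = 1%:M & H *m delta_mx 0 0 = u.
Proof.
move=> u1; pose e : 'cV[R]_n.+1 := delta_mx 0 0.
have [ue|w0] := eqVneq (u - e) 0.
  by exists 1%:M; rewrite ?trmx1 !mul1mx //; apply/eqP; rewrite eq_sym -subr_eq0 ue.
have eu : fdot e u = u 0 0 by rewrite fdot_delta.
have e1 : fdot e e = 1 by rewrite fdot_delta mxE !eqxx.
set w := u - e in w0; pose c := fdot w w.
have cE : c = 2 * (1 - u 0 0).
  by rewrite /c /w !(fdotBl, fdotBr) (fdotC u e) eu e1 u1; ring.
have c0 : c != 0 by rewrite gt_eqF // fdot_gt0.
have ww : w^T *m w = c%:M by rewrite [LHS]mx11_scalar -trace_mx11.
have wx (x : 'cV_n.+1) : w *m w^T *m x = fdot w x *: w.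
  by rewrite -mulmxA [_ *m x]mx11_scalar -trace_mx11 -/(fdot w x) mul_mx_scalar.
exists (1%:M - (2 / c) *: (w *m w^T)).
  rewrite [(1%:M - _)^T]linearB /= [((2 / c) *: _)^T]linearZ /=.
 rewrite trmx1 trmx_mul trmxK.
  rewrite mulmxBl mul1mx mulmxBr mulmx1 -scalemxAl -scalemxAr mulmxA -(mulmxA w).
  rewrite ww mul_mx_scalar -scalemxAl !scalerA.
  rewrite -addrA -opprD [X in _ - X](_ : _ = 0) ?subr0 //.
  rewrite -scalerBl -scalerDl (_ : _ + _ = 0) ?scale0r //.
  by field.
rewrite mulmxBl mul1mx -scalemxAl wx scalerA -/e.
have -> : fdot w e = - (c / 2).
  by rewrite /w fdotBl (fdotC u) eu e1 cE; field.
have -> : 2 / c * - (c / 2) = -1 by field.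
by rewrite scaleN1r opprK /w addrC subrK.
Qed.

Lemma nonneg_rect_diag0 {R : realType} (m n : nat) : nonneg_rect_diag (0 : 'M[R]_(m, n)).
Proof. by move=> i j; rewrite mxE. Qed.

Lemma nonneg_rect_diag_block {R : realType} (m n : nat) (s : R) (S : 'M[R]_(m, n)) :
  0 <= s -> nonneg_rect_diag S ->
  nonneg_rect_diag (block_mx s%:M 0 0 S : 'M[R]_(1 + m, 1 + n)).
Proof.
move=> s0 HS i j.
case: (split_ordP i) => i' ->; case: (split_ordP j) => j' ->.
- by rewrite block_mxEul !ord1 mxE eqxx.
- by rewrite block_mxEur mxE.
- by rewrite block_mxEdl mxE.
- by rewrite block_mxEdr /= eqn_add2l; apply: HS.
Qed.

Lemma svd_zero {R : realType} (m n : nat) :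
  exists (U : 'M[R]_m) (S : 'M[R]_(m, n)) (V : 'M[R]_n),
    [/\ orthogonal_mx U, orthogonal_mx V, nonneg_rect_diag S & 0 = U *m S *m V^T].
Proof.
exists 1%:M, 0, 1%:M; split; rewrite /orthogonal_mx ?trmx1 ?mulmx1 ?mulmx0 //.
exact: nonneg_rect_diag0.
Qed.

(** Induction on the number of rows. Orthogonal [H] and [G] send the first basis vectors to the top
    singular vectors, so [H^T *m D *m G] has [s] in its corner and zeros in the rest of its first
    row and column; the induction hypothesis treats the remaining block. *)
Lemma svd_exists {R : realType} (m n : nat) (D : 'M[R]_(m, n)) :
  exists (U : 'M[R]_m) (S : 'M[R]_(m, n)) (V : 'M[R]_n),
    [/\ orthogonal_mx U, orthogonal_mx V, nonneg_rect_diag S & D = U *m S *m V^T].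
Proof.
have svd0 m' n' (D' : 'M[R]_(m', n')) : D' = 0 ->
  exists (U : 'M[R]_m') (S : 'M[R]_(m', n')) (V : 'M[R]_n'),
    [/\ orthogonal_mx U, orthogonal_mx V, nonneg_rect_diag S & D' = U *m S *m V^T].
  by move=> ->; exact: svd_zero.
elim: m n D => [|m IH] [|n] D.
1-3: by apply: svd0; apply/matrixP => [[]] // ? ? [].
have [->|D0] := eqVneq D 0; first exact: svd0.
have [s [u [v [s0 u1 v1 Dv Du]]]] := top_singular _ D0.
have [H HH He] := householder _ u1; have [G GG Ge] := householder _ v1.
have HH' := mulmx1C HH; have GG' := mulmx1C GG.
pose B : 'M_(1 + m, 1 + n) := H^T *m D *m G.
have Be : B *m delta_mx 0 0 = s *: delta_mx 0 0 :> 'cV_(m.+1).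
  by rewrite -mulmxA Ge -mulmxA Dv -scalemxAr -He mulmxA HH' mul1mx.
have Bte : B^T *m delta_mx 0 0 = s *: delta_mx 0 0 :> 'cV_(n.+1).
  by rewrite !trmx_mul trmxK -mulmxA -mulmxA He Du -scalemxAr -Ge mulmxA GG' mul1mx.
have DE : D = H *m B *m G^T.
  by rewrite /B !mulmxA HH mul1mx -mulmxA GG mulmx1.
clearbody B.
have B0 i : B i 0 = s * (i == 0)%:R.
  by have /matrixP/(_ i 0) := Be; rewrite -colE !mxE andbT.
have Bt0 j : B 0 j = s * (j == 0)%:R.
  by have /matrixP/(_ j 0) := Bte; rewrite -colE !mxE andbT.
have [U [S [V [UU VV HS BE]]]] := IH n (drsubmx B).
have BB : B = block_mx s%:M 0 0 (drsubmx B).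
  rewrite -[LHS]submxK; congr block_mx; apply/matrixP => i j; rewrite !mxE ?ord1 /=.
  - have -> : lshift m (0 : 'I_1) = 0 by apply/val_inj.
    have -> : lshift n (0 : 'I_1) = 0 by apply/val_inj.
    by rewrite B0 eqxx mulr1.
  - have -> : lshift m (0 : 'I_1) = 0 by apply/val_inj.
    by rewrite Bt0 mulr0.
  - have -> : lshift n (0 : 'I_1) = 0 by apply/val_inj.
    by rewrite B0 mulr0.
exists (H *m block_mx (1%:M : 'M_1) 0 0 U : 'M_(1 + m)), (block_mx (s%:M : 'M_1) 0 0 S),
  (G *m block_mx (1%:M : 'M_1) 0 0 V : 'M_(1 + n)).
have blk k (W : 'M[R]_k) : W *m W^T = 1%:M ->
    block_mx (1%:M : 'M_1) 0 0 W *m (block_mx (1%:M : 'M_1) 0 0 W)^T = 1%:M.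
  move=> WW; rewrite tr_block_mx !trmx0 trmx1 mulmx_block.
  by rewrite !(mulmx0, mul0mx, addr0, add0r, mulmx1) WW -scalar_mx_block.
split.
- rewrite /orthogonal_mx trmx_mul mulmxA -(mulmxA H) blk // mulmx1.
  exact: HH.
- rewrite /orthogonal_mx trmx_mul mulmxA -(mulmxA G) blk // mulmx1.
  exact: GG.
- exact: nonneg_rect_diag_block (ltW s0) HS.
rewrite DE trmx_mul BB BE !mulmxA; congr (_ *m _); rewrite -!mulmxA; congr (_ *m _).
suff : block_mx (s%:M : 'M_1) 0 0 (U *m (S *m V^T)) =
    block_mx (1%:M : 'M_1) 0 0 U *m
    (block_mx (s%:M : 'M_1) 0 0 S *m (block_mx (1%:M : 'M_1) 0 0 V)^T) by [].
rewrite tr_block_mx !trmx0 trmx1 !mulmx_block.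
by rewrite !(mulmx0, mul0mx, addr0, add0r, mulmx1, mul1mx).
Qed.

(** * Nuclear norm *)

Lemma fdot_isometry {R : realType} {m n d e : nat} (P : 'M[R]_(m, d)) (Q : 'M_(n, e))
    (A B : 'M_(d, e)) :
  P^T *m P = 1%:M -> Q^T *m Q = 1%:M ->
  fdot (P *m A *m Q^T) (P *m B *m Q^T) = fdot A B.
Proof.
move=> PP QQ; rewrite fdot_mulr trmxK -[P *m B *m _ *m _]mulmxA QQ mulmx1.
by rewrite fdot_mull mulmxA PP mul1mx.
Qed.

Lemma rect_diag_sumE {R : realType} (m n : nat) (S : 'M[R]_(m, n)) :
  nonneg_rect_diag S -> rect_diag_sum S = \sum_i \sum_j S i j.
Proof.
move=> HS; apply: eq_bigr => i _; rewrite big_mkcond; apply: eq_bigr => j _.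
by case: ifPn => // /(proj1 (HS i j)).
Qed.

Lemma rect_diag_sum_ge0 {R : realType} (m n : nat) (S : 'M[R]_(m, n)) :
  nonneg_rect_diag S -> 0 <= rect_diag_sum S.
Proof. by move=> HS; rewrite !sumr_ge0 // => i _; apply: sumr_ge0 => j _; have [] := HS i j. Qed.

Lemma fdot_rect_diag {R : realType} (m n : nat) (S : 'M[R]_(m, n)) :
  nonneg_rect_diag S -> fdot S S <= rect_diag_sum S ^+ 2.
Proof.
move=> HS; have S0 i j : 0 <= S i j by have [] := HS i j.
rewrite fdotE expr2 {1}rect_diag_sumE // mulr_suml; apply: ler_sum => i _.
rewrite mulr_suml; apply: ler_sum => j _; rewrite ler_wpM2l //.
rewrite rect_diag_sumE // (bigD1 i) //= (bigD1 j) //= -addrA lerDl.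
by rewrite addr_ge0 ?sumr_ge0 // => k _; rewrite sumr_ge0.
Qed.

Lemma fdot_svd {R : realType} (m n : nat) (U : 'M[R]_m) (S : 'M[R]_(m, n)) (V : 'M_n) :
  orthogonal_mx U -> orthogonal_mx V -> fdot (U *m S *m V^T) (U *m S *m V^T) = fdot S S.
Proof. by move=> /mulmx1C UU /mulmx1C VV; rewrite fdot_isometry. Qed.

(** The point is that the set under [sup] is bounded: a diagonal entry satisfies
    [2 * S i j <= S i j ^+ 2 + 1], and its square is at most [fdot A A]. *)
Lemma svd_sum_le_nucnorm {R : realType} (m n : nat) (A : 'M[R]_(m, n)) x :
  svd_sum A x -> x <= nucnorm A.
Proof.
move=> Ax; apply: ub_le_sup => //.
exists (\sum_(i < m) \sum_(j < n | nat_of_ord i == nat_of_ord j) (fdot A A + 1)) => y.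
move=> [U [S [V [UU VV HS AE ->]]]].
apply: ler_sum => i _; apply: ler_sum => j _.
have := sqr_le_fdot S i j; have := fdot_ge0 A; rewrite AE fdot_svd //.
by have := sqr_ge0 (S i j - 1); nra.
Qed.

Lemma svd_sum_exists {R : realType} (m n : nat) (A : 'M[R]_(m, n)) :
  exists x, svd_sum A x.
Proof.
have [U [S [V [UU VV HS AE]]]] := svd_exists _ _ A.
by exists (rect_diag_sum S), U, S, V.
Qed.

Lemma nucnorm_ge0 {R : realType} (m n : nat) (A : 'M[R]_(m, n)) : 0 <= nucnorm A.
Proof.
have [x Ax] := svd_sum_exists _ _ A; apply: le_trans (svd_sum_le_nucnorm _ _ _ _ Ax).
by have [U [S [V [_ _ HS _ ->]]]] := Ax; exact: rect_diag_sum_ge0.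
Qed.

(** The Euclidean norm of the singular values is at most their sum. *)
Lemma fdot_le_nucnorm {R : realType} (m n : nat) (A : 'M[R]_(m, n)) :
  fdot A A <= nucnorm A ^+ 2.
Proof.
have [x Ax] := svd_sum_exists _ _ A; have xA := svd_sum_le_nucnorm _ _ _ _ Ax.
have [U [S [V [UU VV HS AE xE]]]] := Ax.
have x0 : 0 <= x by rewrite xE rect_diag_sum_ge0.
rewrite {1 2}AE fdot_svd // (le_trans (fdot_rect_diag _ _ _ HS)) // -xE.
by rewrite ler_sqr ?nnegrE // nucnorm_ge0.
Qed.

(** The projection [K *m K^T] is symmetric and idempotent, so its diagonal entry [x] is the squared
    norm of its row [i], whence [x ^+ 2 <= x]. *)
Lemma orthonormal_cols_row_le1 {R : realType} {m d : nat} (K : 'M[R]_(m, d)) i :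
  K^T *m K = 1%:M -> fdot (row i K) (row i K) <= 1.
Proof.
move=> KK; set x := fdot _ _.
have xE : x = (K *m K^T) i i.
  by rewrite /x fdotE big_ord1 mxE; apply: eq_bigr => j _; rewrite !mxE.
have : (K *m K^T *m (K *m K^T)) i i = x.
  by rewrite mulmxA -(mulmxA K) KK mulmx1.
rewrite mxE (bigD1 i) //= -xE => xx.
have : x ^+ 2 <= x.
  rewrite -{2}xx expr2 lerDl sumr_ge0 // => k _.
  have -> : (K *m K^T) k i = (K *m K^T) i k.
    by rewrite !mxE; apply: eq_bigr => j _; rewrite !mxE mulrC.
  by rewrite -expr2 sqr_ge0.
by have := fdot_ge0 (row i K); rewrite -/x; nra.
Qed.

(* Trace duality: the nuclear norm of a square matrix is its pairing with an orthogonal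
   matrix, which pulls back to a pairing of M with a contraction. *)
Lemma nucnorm_compression {R : realType} {m n d : nat} (P : 'M[R]_(m, d))
    (Q : 'M_(n, d)) (M : 'M_(m, n)) :
  P^T *m P = 1%:M -> Q^T *m Q = 1%:M -> nucnorm (P^T *m M *m Q) <= nucnorm M.
Proof.
move=> PP QQ; apply: ge_sup; first exact: svd_sum_exists.
move=> _ [U [S [V [UU VV HS DE ->]]]].
have [y My] := svd_sum_exists _ _ M.
apply: le_trans (svd_sum_le_nucnorm _ _ _ _ My).
have [U' [S' [V' [UU' VV' HS' ME ->]]]] := My.
have [/mulmx1C U1 /mulmx1C V1] := (UU, VV).
have SE : S = U^T *m (P^T *m M *m Q) *m V.
  by rewrite DE !mulmxA U1 mul1mx -mulmxA V1 mulmx1.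
pose K := U'^T *m (P *m U); pose L := V'^T *m (Q *m V).
have orth k (X : 'M[R]_k) (F : 'M_(k, d)) (Y : 'M_d) : X *m X^T = 1%:M -> F^T *m F = 1%:M ->
    Y^T *m Y = 1%:M -> (X^T *m (F *m Y))^T *m (X^T *m (F *m Y)) = 1%:M.
  move=> XX FF YY; rewrite !trmx_mul trmxK !mulmxA -(mulmxA _ X) XX mulmx1.
  by rewrite -(mulmxA _ _ F) FF mulmx1.
have KK : K^T *m K = 1%:M by apply: orth.
have LL : L^T *m L = 1%:M by apply: orth.
have -> : rect_diag_sum S = fdot (S' *m L) K.
  transitivity (\tr S).
    apply: eq_bigr => i _; rewrite (bigD1 i) //= big1 ?addr0 // => j /andP[/eqP/val_inj ->].
    by rewrite eqxx.
  rewrite SE fdotC /fdot /K /L {1}ME !trmx_mul trmxK.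
  by rewrite !mulmxA.
rewrite fdot_mulr fdotE rect_diag_sumE //.
apply: ler_sum => i _; apply: ler_sum => j _.
(* The coefficient of [S' i j] is the inner product of two rows of norm at most 1, hence at most
   1. *)
rewrite ler_piMr //; first by have [] := HS' i j.
have -> : (K *m L^T) i j = fdot (row i K) (row j L).
  by rewrite fdotE big_ord1 mxE; apply: eq_bigr => k _; rewrite !mxE.
have := orthonormal_cols_row_le1 _ i KK; have := orthonormal_cols_row_le1 _ j LL.
have := fdot_ge0 (row i K - row j L).
by rewrite !(fdotBl, fdotBr) (fdotC (row j L)); lra.
Qed.

(** * Concentration for independent Bernoulli variables *)

(** Invert [1 - z <= expR (- z)]; then [(1 + z + 2 * z ^+ 2) * (1 - z) = 1 + z ^+ 2 * (1 - 2 * z)]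
    is at least 1. *)
Lemma expR_le_quad {R : realType} (z : R) : z <= 2^-1 -> expR z <= 1 + z + 2 * z ^+ 2.
Proof.
move=> z2; have z1 : 0 < 1 - z by lra.
have -> : expR z = (expR (- z))^-1 by rewrite expRN invrK.
apply: (@le_trans _ _ (1 - z)^-1).
  by rewrite lef_pV2 ?posrE ?expR_gt0 // expR_ge1Dx.
by rewrite -div1r ler_pdivrMr //; have := sqr_ge0 z; nra.
Qed.

(** Centred at the mean, the two exponents are [w' * a] and [- (w * a)] with [a = l * (x - y)]. In
    the weighted sum of the quadratic bounds the linear terms cancel, and [1 + u <= expR u] absorbs
    what is left. *)
Lemma two_point_mgf {R : realType} (w w' x y c l : R) :
  0 <= w -> 0 <= w' -> w + w' = 1 -> `|x - y| <= c -> 0 <= l -> l * c <= 2^-1 ->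
  w * expR (l * x) + w' * expR (l * y)
    <= expR (2 * (l * c) ^+ 2) * expR (l * (w * x + w' * y)).
Proof.
move=> w0 w'0 ww xy l0 lc; set mu := w * x + w' * y.
have [lxy lyx] : l * (x - y) <= l * c /\ l * (y - x) <= l * c.
  by move: xy; rewrite ler_norml => /andP[xy yx]; split; apply: ler_wpM2l => //; lra.
have dx : l * x - l * mu = w' * (l * (x - y)).
  by rewrite /mu (_ : w = 1 - w'); [ring | lra].
have dy : l * y - l * mu = w * (l * (y - x)).
  by rewrite /mu (_ : w' = 1 - w); [ring | lra].
have w1 : w <= 1 by lra.
have w'1 : w' <= 1 by lra.
set a := l * (x - y) in lxy dx; have ya : l * (y - x) = - a by rewrite /a; ring.
rewrite ya in lyx dy.
have ex : expR (l * x - l * mu) <= 1 + w' * a + 2 * (w' * a) ^+ 2.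
  by rewrite dx; apply: expR_le_quad; nra.
have ey : expR (l * y - l * mu) <= 1 + w * - a + 2 * (w * - a) ^+ 2.
  by rewrite dy; apply: expR_le_quad; nra.
have split_exp u : expR (l * u) = expR (l * u - l * mu) * expR (l * mu).
  by rewrite -expRD subrK.
rewrite (split_exp x) (split_exp y) !(mulrA _ _ (expR (l * mu))) -mulrDl ler_wpM2r ?expR_ge0 //.
apply: (@le_trans _ _ (1 + 2 * (l * c) ^+ 2)); last exact: expR_ge1Dx.
have ac : a ^+ 2 <= (l * c) ^+ 2 by nra.
apply: (le_trans (lerD (ler_wpM2l w0 ex) (ler_wpM2l w'0 ey))).
have -> : w * (1 + w' * a + 2 * (w' * a) ^+ 2) + w' * (1 + w * - a + 2 * (w * - a) ^+ 2)
  = (w + w') + 2 * ((w * w') * (w + w')) * a ^+ 2 by ring.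
rewrite ww mulr1 lerD2l -mulrA ler_wpM2l //.
apply: le_trans ac; rewrite ler_piMl ?sqr_ge0 //.
by rewrite mulr_ile1.
Qed.

(** * Coordinate flips and product expectations on the Boolean cube *)

Definition flip {I : finType} (k : I) (A : {ffun I -> bool}) : {ffun I -> bool} :=
  [ffun i => A i (+) (i == k)].

Lemma flipK {I : finType} (k : I) : involutive (flip k).
Proof. by move=> A; apply/ffunP => i; rewrite !ffunE addbK. Qed.

Lemma flipC {I : finType} (j k : I) A : flip j (flip k A) = flip k (flip j A).
Proof. by apply/ffunP => i; rewrite !ffunE -!addbA (addbC (i == k)). Qed.

Lemma flip_id {I : finType} (k : I) A : flip k A k = ~~ A k.
Proof. by rewrite ffunE eqxx addbT. Qed.

Lemma flip_neq {I : finType} (j k : I) A : j != k -> flip j A k = A k.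
Proof. by move=> jk; rewrite ffunE eq_sym (negPf jk) addbF. Qed.

Lemma flip_invariant_const {I : finType} {T : Type} (f : {ffun I -> bool} -> T) :
  (forall k A, f (flip k A) = f A) -> forall A B, f A = f B.
Proof.
move=> f_inv A B.
have foldE l i : uniq l -> foldr flip A l i = A i (+) (i \in l).
  elim: l => [|k l IH] /=; first by rewrite addbF.
  move=> /andP[kl /IH]; rewrite ffunE in_cons => ->.
  by have [->|] := eqVneq i k; rewrite ?(negPf kl) ?addbF.
pose l := [seq i <- enum I | A i != B i].
have <- : foldr flip A l = B.
  apply/ffunP => i; rewrite foldE; last by rewrite filter_uniq // enum_uniq.
  rewrite mem_filter mem_enum andbT.
  by case: (A i) (B i) => [] [].
by elim: l => //= k l IH; rewrite f_inv.
Qed.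

Definition bern_weight {R : realType} (p : R) (b : bool) : R := if b then p else 1 - p.

Definition bern_prob {R : realType} {I : finType} (p : I -> R) (A : {ffun I -> bool}) : R :=
  \prod_i bern_weight (p i) (A i).

Definition bern_E {R : realType} {I : finType} (p : I -> R) (f : {ffun I -> bool} -> R) : R :=
  \sum_A bern_prob p A * f A.

(** The conditional expectation given all coordinates but [k], kept as a function on the whole cube
    so that averaging can be iterated without changing the index type. *)
Definition coord_avg {R : realType} {I : finType} (p : I -> R) (k : I)
    (f : {ffun I -> bool} -> R) (A : {ffun I -> bool}) : R :=
  bern_weight (p k) (A k) * f A + bern_weight (p k) (~~ A k) * f (flip k A).

Lemma bern_weightD {R : realType} (p : R) b : bern_weight p b + bern_weight p (~~ b) = 1.
Proof. by case: b; rewrite /bern_weight /= ?subrK // addrC subrK. Qed.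

Lemma bern_weight_ge0 {R : realType} (p : R) b : 0 <= p <= 1 -> 0 <= bern_weight p b.
Proof. by case: b => /andP[p0 p1]; rewrite /bern_weight ?subr_ge0. Qed.

Lemma bern_prob_ge0 {R : realType} {I : finType} (p : I -> R) A :
  (forall i, 0 <= p i <= 1) -> 0 <= bern_prob p A.
Proof. by move=> p01; apply: prodr_ge0 => i _; apply: bern_weight_ge0. Qed.

(** The product form replaces a ratio of weights, so [p k] may be 0 or 1. *)
Lemma bern_prob_flip {R : realType} {I : finType} (p : I -> R) k A :
  bern_prob p (flip k A) * bern_weight (p k) (A k)
  = bern_prob p A * bern_weight (p k) (~~ A k).
Proof.
rewrite /bern_prob (bigD1 k) //= [in RHS](bigD1 k) //= flip_id.
rewrite (eq_bigr (fun i => bern_weight (p i) (A i))); first by ring.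
by move=> i ik; rewrite flip_neq // eq_sym.
Qed.

Lemma bern_E_avg {R : realType} {I : finType} (p : I -> R) k f :
  bern_E p (coord_avg p k f) = bern_E p f.
Proof.
rewrite /bern_E /coord_avg; under eq_bigr do rewrite mulrDr.
rewrite big_split /= [X in _ + X](reindex_inj (inv_inj (flipK k))) -big_split /=.
apply: eq_bigr => A _; rewrite flipK flip_id negbK [X in _ + X]mulrA bern_prob_flip.
by rewrite [X in X + _]mulrA -mulrDl -mulrDr bern_weightD mulr1.
Qed.

Lemma bern_E_cst {R : realType} {I : finType} (p : I -> R) a : bern_E p (fun=> a) = a.
Proof.
rewrite /bern_E -mulr_suml -(bigA_distr_bigA (fun i b => bern_weight (p i) b)) /=.
rewrite big1 ?mul1r // => i _.
by rewrite big_bool; apply: (bern_weightD _ true).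
Qed.

Lemma bern_ED {R : realType} {I : finType} (p : I -> R) f g :
  bern_E p (fun A => f A + g A) = bern_E p f + bern_E p g.
Proof. by rewrite /bern_E -big_split /=; apply: eq_bigr => A _; rewrite mulrDr. Qed.

Lemma bern_EZ {R : realType} {I : finType} (p : I -> R) a f :
  bern_E p (fun A => a * f A) = a * bern_E p f.
Proof. by rewrite /bern_E mulr_sumr; apply: eq_bigr => A _; rewrite mulrCA. Qed.

Lemma bern_E_sum {R : realType} {I J : finType} (p : I -> R) (f : J -> {ffun I -> bool} -> R) :
  bern_E p (fun A => \sum_j f j A) = \sum_j bern_E p (f j).
Proof.
by rewrite /bern_E exchange_big /=; apply: eq_bigr => A _; rewrite mulr_sumr.
Qed.

Lemma ler_bern_E {R : realType} {I : finType} (p : I -> R) f g :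
  (forall i, 0 <= p i <= 1) -> (forall A, f A <= g A) -> bern_E p f <= bern_E p g.
Proof. by move=> p01 fg; apply: ler_sum => A _; rewrite ler_wpM2l ?bern_prob_ge0. Qed.

Lemma sqr_bern_E_le {R : realType} {I : finType} (p : I -> R) f :
  (forall i, 0 <= p i <= 1) -> bern_E p f ^+ 2 <= bern_E p (fun A => f A ^+ 2).
Proof.
move=> p01; set mu := bern_E p f.
have : bern_E p (fun=> 0) <= bern_E p (fun A => f A ^+ 2 + (- (2 * mu) * f A + mu ^+ 2)).
  apply: ler_bern_E => // A.
  by have := sqr_ge0 (f A - mu); congr (_ <= _); ring.
rewrite bern_E_cst !bern_ED bern_EZ bern_E_cst -/mu => H.
by rewrite -subr_ge0; move: H; congr (_ <= _); ring.
Qed.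

(** Averaging over coordinate [i] alone already makes the integrand constant. *)
Lemma bern_E_cov {R : realType} {I : finType} (p : I -> R) i j :
  bern_E p (fun A => ((A i)%:R - p i) * ((A j)%:R - p j))
  = if i == j then p i * (1 - p i) else 0.
Proof.
rewrite -(bern_E_avg p i) -[RHS](bern_E_cst p); apply: eq_bigr => A _; congr (_ * _).
rewrite /coord_avg flip_id /bern_weight.
have [<-|ij] := eqVneq i j; first by rewrite flip_id; case: (A i) => /=; ring.
by rewrite flip_neq //; case: (A i) => /=; ring.
Qed.

Lemma bern_E_linear_sqr {R : realType} {I : finType} (p a : I -> R) :
  bern_E p (fun A => (\sum_i a i * ((A i)%:R - p i)) ^+ 2)
  = \sum_i a i ^+ 2 * (p i * (1 - p i)).
Proof.
transitivity (bern_E p (fun A => \sum_i \sum_j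
    a i * a j * (((A i)%:R - p i) * ((A j)%:R - p j)))).
  apply: eq_bigr => A _; congr (_ * _); rewrite expr2 mulr_suml; apply: eq_bigr => i _.
  by rewrite mulr_sumr; apply: eq_bigr => j _; ring.
rewrite bern_E_sum; apply: eq_bigr => i _; rewrite bern_E_sum (bigD1 i) //= big1 ?addr0.
  by rewrite bern_EZ bern_E_cov eqxx -expr2.
by move=> j ji; rewrite bern_EZ bern_E_cov eq_sym (negPf ji) mulr0.
Qed.

(* Averaging out one coordinate at a time preserves the mean and the bounded differences,
   and costs a factor at most [expR (2 * (l * c) ^+ 2)] in the moment generating function. *)
Lemma bounded_differences_mgf {R : realType} {I : finType} (p : I -> R) (c l : R) f :
  (forall i, 0 <= p i <= 1) -> 0 <= l -> l * c <= 2^-1 ->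
  (forall k A, `|f (flip k A) - f A| <= c) ->
  bern_E p (fun A => expR (l * (f A - bern_E p f))) <= expR (2 * (l * c) ^+ 2 * #|I|%:R).
Proof.
move=> p01 l0 lc f_bd; rewrite cardE.
(* The induction is on a list containing every coordinate on which [f] may still depend; when it is
   empty, [f] is constant. *)
have : forall k A, k \notin enum I -> f (flip k A) = f A by move=> k A; rewrite mem_enum.
elim: (enum I) f f_bd => [|k s IH] f f_bd f_inv.
  have f_cst := flip_invariant_const f (fun k A => f_inv k A isT).
  rewrite mulr0 expR0 -[leRHS](bern_E_cst p); apply: ler_bern_E => // A.
  have -> : bern_E p f = f A.
    by rewrite -[RHS](bern_E_cst p); apply: eq_bigr => B _; rewrite (f_cst B A).
  by rewrite subrr mulr0 expR0.
have w0 j b : 0 <= bern_weight (p j) b by apply: bern_weight_ge0.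
pose g := coord_avg p k f.
have gk A : g (flip k A) = g A.
  by rewrite /g /coord_avg flip_id negbK flipK addrC.
have g_bd j A : `|g (flip j A) - g A| <= c.
  have [->|jk] := eqVneq j k; first by rewrite gk subrr normr0 (le_trans _ (f_bd k A)).
  rewrite /g /coord_avg flip_neq // flipC.
  rewrite opprD addrACA -!mulrBr (le_trans (ler_normD _ _)) // !normrM !(ger0_norm (w0 _ _)).
  rewrite (le_trans (lerD (ler_wpM2l (w0 _ _) (f_bd _ _)) (ler_wpM2l (w0 _ _) (f_bd _ _)))) //.
  by rewrite -mulrDl bern_weightD mul1r.
have g_inv j A : j \notin s -> g (flip j A) = g A.
  move=> js; have [->|jk] := eqVneq j k; first exact: gk.
  by rewrite /g /coord_avg flip_neq // flipC !(f_inv j) // in_cons negb_or jk.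
have Eg : bern_E p g = bern_E p f by apply: bern_E_avg.
have := IH g g_bd g_inv; rewrite Eg => IHg.
rewrite -(bern_E_avg p k) /= -[(size s).+1%:R]natr1 mulrDr mulr1 addrC expRD.
apply: le_trans (ler_wpM2l (expR_ge0 _) IHg).
rewrite -bern_EZ; apply: ler_bern_E => // A; rewrite {1}/coord_avg.
have := two_point_mgf (bern_weight (p k) (A k)) (bern_weight (p k) (~~ A k))
  (f A - bern_E p f) (f (flip k A) - bern_E p f) c l.
rewrite opprB addrA subrK distrC => /(_ (w0 _ _) (w0 _ _) (bern_weightD _ _) (f_bd _ _) l0 lc).
move=> /le_trans; apply; rewrite le_eqVlt; apply/orP; left; apply/eqP.
congr (_ * expR (l * _)); rewrite !mulrBr addrACA -opprD -mulrDl bern_weightD mul1r.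
by rewrite /g /coord_avg.
Qed.

(** Markov's inequality for the exponential moment: on [Q] the exponential is at least
    [expR (l * s)]. *)
Lemma bounded_differences_tail {R : realType} {I : finType} (p : I -> R) (c l s : R) f
    (Q : pred {ffun I -> bool}) :
  (forall i, 0 <= p i <= 1) -> 0 <= l -> l * c <= 2^-1 ->
  (forall k A, `|f (flip k A) - f A| <= c) ->
  (forall A, Q A -> s <= f A - bern_E p f) ->
  \sum_(A | Q A) bern_prob p A <= expR (2 * (l * c) ^+ 2 * #|I|%:R - l * s).
Proof.
move=> p01 l0 lc f_bd Qs.
have mgf := bounded_differences_mgf p c l f p01 l0 lc f_bd.
rewrite expRD mulrC -ler_pdivrMl ?expR_gt0 // expRN invrK.
apply: le_trans mgf; rewrite /bern_E big_mkcond mulr_sumr; apply: ler_sum => A _.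
case: ifPn => QA; last by rewrite mulr0 mulr_ge0 ?bern_prob_ge0 ?expR_ge0.
by rewrite mulrC ler_wpM2l ?bern_prob_ge0 // ler_expR ler_wpM2l // Qs.
Qed.

(** * Noise of the revealed matrix *)

Definition mx_of_ffun {T : Type} {m n : nat} (A : {ffun 'I_m * 'I_n -> T}) : 'M[T]_(m, n) :=
  \matrix_(i, j) A (i, j).

Definition reveal_prob {R : realType} {m n : nat} (rho : R) (M : 'M[R]_(m, n))
    (x : 'I_m * 'I_n) : R := M x.1 x.2 * (1 - rho).

Lemma reveal_prob_itv {R : realType} {m n : nat} (rho : R) (M : 'M[R]_(m, n)) x :
  0 <= rho < 1 -> (forall i j, 0 <= M i j <= 1) -> 0 <= reveal_prob rho M x <= 1.
Proof.
move=> /andP[rho0 rho1] M01; have /andP[M0 M1] := M01 x.1 x.2.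
by rewrite mulr_ge0 ?mulr_ile1 ?subr_ge0 ?(ltW rho1) // gerBl.
Qed.

Lemma Prob_bern {R : realType} {m n : nat} (rho : R) (M : 'M_(m, n)) E :
  Prob rho M E = \sum_(A | `[< E (mx_of_ffun A) >])
    bern_prob (reveal_prob rho M) A.
Proof.
pose h (B : 'M[bool]_(m, n)) := [ffun x => B x.1 x.2].
rewrite /Prob (reindex (@mx_of_ffun bool m n)) /=; last first.
  exists h => [A _|B _]; first by apply/ffunP => -[i j]; rewrite ffunE mxE.
  by apply/matrixP => i j; rewrite mxE ffunE.
apply: eq_bigr => A _; rewrite /probA /bern_prob pair_bigA /=.
by apply: eq_bigr => -[i j] _; rewrite mxE.
Qed.

Lemma Prob_ge {R : realType} {m n : nat} (rho e : R) (M : 'M_(m, n)) E :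
  \sum_(A | ~~ `[< E (mx_of_ffun A) >]) bern_prob (reveal_prob rho M) A <= e ->
  1 - e <= Prob rho M E.
Proof.
rewrite Prob_bern lerBlDr; set p := reveal_prob rho M.
have <- : \sum_A bern_prob p A = 1.
  by rewrite -[RHS](bern_E_cst p); apply: eq_bigr => A _; rewrite mulr1.
move=> H; rewrite [leLHS](bigID (fun A => `[< E (mx_of_ffun A) >])) /= lerD2l.
exact: H.
Qed.

Definition noise {R : realType} {m n : nat} (rho : R) (M : 'M[R]_(m, n))
    (A : {ffun 'I_m * 'I_n -> bool}) : 'M[R]_(m, n) :=
  \matrix_(i, j) ((A (i, j))%:R / (1 - rho) - M i j).

Lemma ltildeE {R : realType} (rho x : R) (a : bool) :
  rho < 1 -> ltilde rho x a = x ^+ 2 - a%:R / (1 - rho) * (2 * x - 1).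
Proof.
move=> rho1; have q0 : 1 - rho != 0 by rewrite gt_eqF // subr_gt0.
by case: a; rewrite /ltilde /=; field.
Qed.

Lemma feasible_compression {R : realType} {m n d : nat} (M : 'M[R]_(m, n))
    (Fu : 'M[R]_(m, d)) (Fv : 'M[R]_(n, d)) (t : R) :
  (forall i j, 0 <= M i j <= 1) -> nucnorm M <= t ->
  Fu^T *m Fu = 1%:M -> Fv^T *m Fv = 1%:M ->
  M = Fu *m Fu^T *m M *m Fv *m Fv^T ->
  feasible t Fu Fv (Fu^T *m M *m Fv).
Proof.
move=> M01 Mt UU VV ME; split; first exact: le_trans (nucnorm_compression _ _ _ UU VV) Mt.
by move=> i j; rewrite !mulmxA -ME.
Qed.

(** The objective at [X] minus that at [M] equals, entry by entry, the left side minus the right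
    side; optimality makes it nonpositive. *)
Lemma optimal_noise {R : realType} {m n d : nat} (rho t : R) (M : 'M[R]_(m, n))
    (Fu : 'M[R]_(m, d)) (Fv : 'M[R]_(n, d)) A D D0 :
  rho < 1 -> feasible t Fu Fv D0 -> Fu *m D0 *m Fv^T = M ->
  optimal rho t Fu Fv (mx_of_ffun A) D ->
  let X := Fu *m D *m Fv^T in
  fdot (X - M) (X - M) <= 2 * fdot (X - M) (noise rho M A).
Proof.
move=> rho1 fD0 D0M [fD /(_ _ fD0)]; rewrite /objective D0M /=.
set X := Fu *m D *m Fv^T => H.
rewrite -subr_le0; apply: le_trans (_ : _ <= _ - _) _; last first.
  by rewrite subr_le0; exact: H.
rewrite !fdotE mulr_sumr -!sumrB; apply: ler_sum => i _.
rewrite mulr_sumr -!sumrB; apply: ler_sum => j _.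
rewrite !ltildeE // !mxE le_eqVlt; apply/orP; left; apply/eqP.
by set a := _ / _; ring.
Qed.

Lemma fdot_sub_le {R : realType} {m n : nat} (X M : 'M[R]_(m, n)) :
  (forall i j, 0 <= X i j) -> (forall i j, 0 <= M i j) ->
  fdot (X - M) (X - M) <= fdot X X + fdot M M.
Proof.
move=> X0 M0; have : 0 <= fdot X M.
  by rewrite fdotE sumr_ge0 // => i _; apply: sumr_ge0 => j _; rewrite mulr_ge0.
by rewrite !(fdotBl, fdotBr) (fdotC M X); lra.
Qed.

(* Nonnegativity of the entries of both matrices improves the constant [2 * t] of the
   triangle inequality to [Num.sqrt 2 * t], so that the Frobenius norm of the compressed
   noise suffices in place of its operator norm. *)
Lemma feasible_sub_fdot {R : realType} {m n d : nat} (t : R) (Fu : 'M[R]_(m, d))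
    (Fv : 'M[R]_(n, d)) D D0 :
  Fu^T *m Fu = 1%:M -> Fv^T *m Fv = 1%:M ->
  feasible t Fu Fv D -> feasible t Fu Fv D0 ->
  fdot (D - D0) (D - D0) <= 2 * t ^+ 2.
Proof.
move=> UU VV [Dt D01] [D0t D001].
rewrite -(fdot_isometry Fu Fv _ _ UU VV) mulmxBr mulmxBl.
apply: le_trans (fdot_sub_le _ _ _ _) _ => [i j|i j|].
- by have /andP[] := D01 i j.
- by have /andP[] := D001 i j.
have sq (D' : 'M[R]_d) : nucnorm D' <= t -> fdot D' D' <= t ^+ 2.
  move=> D't; apply: le_trans (fdot_le_nucnorm _ _ _) _.
  by rewrite ler_sqr ?nnegrE ?nucnorm_ge0 // (le_trans (nucnorm_ge0 _ _ D')).
by rewrite !fdot_isometry // mulr_natl mulr2n lerD // sq.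
Qed.

(** A flip moves a single entry of the noise, by [(1 - rho)^-1] up or down. *)
Lemma noise_flip {R : realType} {m n : nat} (rho : R) (M Y : 'M[R]_(m, n)) k A :
  rho < 1 -> (forall i j, `|Y i j| <= 1) ->
  fdot Y (noise rho M (flip k A)) <= fdot Y (noise rho M A) + (1 - rho)^-1.
Proof.
move=> rho1 Y1; have q0 : 0 < (1 - rho)^-1 by rewrite invr_gt0 subr_gt0.
rewrite addrC -lerBlDr -fdotBr fdotE pair_bigA (bigD1 k) //= big1 ?addr0; last first.
  by move=> [i j] ik; rewrite !mxE flip_neq 1?eq_sym // subrr mulr0.
rewrite !mxE -surjective_pairing flip_id.
have := Y1 k.1 k.2; rewrite ler_norml => /andP[Yl Yu].
by case: (A k) => /=; rewrite ?mul0r ?mul1r; nra.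
Qed.

(** * Supremum of the noise over the feasible set *)

Definition max_noise {R : realType} {m n d : nat} (rho t : R) (M : 'M[R]_(m, n))
    (Fu : 'M[R]_(m, d)) (Fv : 'M[R]_(n, d)) A : R :=
  sup [set fdot (Fu *m D *m Fv^T - M) (noise rho M A) | D in feasible t Fu Fv]%classic.

Definition compressed_noise {R : realType} {m n d : nat} (rho : R) (M : 'M[R]_(m, n))
    (Fu : 'M[R]_(m, d)) (Fv : 'M[R]_(n, d)) A : 'M[R]_d :=
  Fu^T *m noise rho M A *m Fv.

(** Each of the [d ^ 2] entries is a linear form in independent centred variables of variance at
    most [1 - rho]; by orthonormality its squared coefficients sum to [(1 - rho) ^- 2]. *)
Lemma compressed_noise_moment {R : realType} {m n d : nat} (rho : R) (M : 'M[R]_(m, n))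
    (Fu : 'M[R]_(m, d)) (Fv : 'M[R]_(n, d)) :
  0 <= rho < 1 -> (forall i j, 0 <= M i j <= 1) ->
  Fu^T *m Fu = 1%:M -> Fv^T *m Fv = 1%:M ->
  bern_E (reveal_prob rho M)
    (fun A => fdot (compressed_noise rho M Fu Fv A) (compressed_noise rho M Fu Fv A))
  <= d%:R ^+ 2 / (1 - rho).
Proof.
move=> rho01 M01 UU VV; have [rho0 rho1] := andP rho01; have q0 : 0 < 1 - rho by rewrite subr_gt0.
set p := reveal_prob rho M.
pose a k l (x : 'I_m * 'I_n) := Fu x.1 k * Fv x.2 l / (1 - rho).
have col1 r (F : 'M[R]_(r, d)) k : F^T *m F = 1%:M -> \sum_i F i k ^+ 2 = 1.
  move=> /matrixP/(_ k k); rewrite !mxE eqxx => H; rewrite -[RHS]H.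
  by apply: eq_bigr => i _; rewrite mxE expr2.
have WE A k l : compressed_noise rho M Fu Fv A k l = \sum_x a k l x * ((A x)%:R - p x).
  rewrite mxE (eq_bigr (fun j => \sum_i a k l (i, j) * ((A (i, j))%:R - p (i, j)))).
    by rewrite exchange_big pair_bigA; apply: eq_bigr => -[].
  move=> j _; rewrite mxE mulr_suml; apply: eq_bigr => i _; rewrite !mxE /a /p /reveal_prob /=.
  by field; rewrite gt_eqF.
have E1 k l : bern_E p (fun A => compressed_noise rho M Fu Fv A k l ^+ 2) <= (1 - rho)^-1.
  rewrite (_ : bern_E _ _ = \sum_x a k l x ^+ 2 * (p x * (1 - p x))); last first.
    by rewrite -bern_E_linear_sqr; apply: eq_bigr => A _; rewrite WE.
  apply: (@le_trans _ _ (\sum_x a k l x ^+ 2 * (1 - rho))).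
    apply: ler_sum => x _; rewrite ler_wpM2l ?sqr_ge0 // /p /reveal_prob.
    have /andP[M0 M1] := M01 x.1 x.2; set q := 1 - rho in q0 *; set y := _ * q.
    have y0 : 0 <= y by rewrite mulr_ge0 // ltW.
    have yq : y <= q by rewrite ler_piMl // ltW.
    by have := sqr_ge0 y; nra.
  rewrite -(pair_bigA _ (fun i j => a k l (i, j) ^+ 2 * (1 - rho))) /=.
  have -> : (1 - rho)^-1 = (\sum_i Fu i k ^+ 2) * (\sum_j Fv j l ^+ 2) / (1 - rho).
    by rewrite !col1 // !mul1r.
  rewrite !mulr_suml; apply: ler_sum => i _; rewrite mulr_sumr mulr_suml; apply: ler_sum => j _.
  by rewrite /a /= le_eqVlt; apply/orP; left; apply/eqP; field; rewrite gt_eqF.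
have -> : d%:R ^+ 2 / (1 - rho) = \sum_(k < d) \sum_(l < d) (1 - rho)^-1.
  by rewrite !sumr_const card_ord -mulrnA -[RHS]mulr_natl natrM expr2.
apply: (@le_trans _ _
    (\sum_k \sum_l bern_E p (fun A => compressed_noise rho M Fu Fv A k l ^+ 2))).
  under eq_bigr do rewrite -bern_E_sum; rewrite -bern_E_sum.
  by apply: ler_bern_E => [x|A]; [exact: reveal_prob_itv | rewrite fdotE].
by apply: ler_sum => k _; apply: ler_sum => l _; exact: E1.
Qed.

Section MaxNoise.
Context {R : realType} {m n d : nat} (rho t : R) (M : 'M[R]_(m, n)).
Context (Fu : 'M[R]_(m, d)) (Fv : 'M[R]_(n, d)) (D0 : 'M[R]_d).
Hypotheses (rho01 : 0 <= rho < 1) (M01 : forall i j, 0 <= M i j <= 1).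
Hypotheses (UU : Fu^T *m Fu = 1%:M) (VV : Fv^T *m Fv = 1%:M).
Hypotheses (fD0 : feasible t Fu Fv D0) (D0M : Fu *m D0 *m Fv^T = M).

Let f := max_noise rho t M Fu Fv.
Let p := reveal_prob rho M.
Let W := compressed_noise rho M Fu Fv.

Let p01 x : 0 <= p x <= 1. Proof. exact: reveal_prob_itv. Qed.

Lemma feasible_entry D i j : feasible t Fu Fv D -> `|(Fu *m D *m Fv^T - M) i j| <= 1.
Proof.
move=> [_ /(_ i j)]; rewrite !mxE; move: (M01 i j) => /andP[? ?] /andP[? ?].
by rewrite ler_norml; apply/andP; split; lra.
Qed.

Lemma le_max_noise A D : feasible t Fu Fv D ->
  fdot (Fu *m D *m Fv^T - M) (noise rho M A) <= f A.
Proof.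
move=> fD; apply: ub_le_sup; last by exists D.
exists (\sum_i \sum_j `|noise rho M A i j|) => _ [D' fD' <-].
rewrite fdotE; apply: ler_sum => i _; apply: ler_sum => j _.
rewrite (le_trans (ler_norm _)) // normrM ler_piMl //.
exact: feasible_entry.
Qed.

Lemma max_noise_le A y :
  (forall D, feasible t Fu Fv D -> fdot (Fu *m D *m Fv^T - M) (noise rho M A) <= y) -> f A <= y.
Proof.
move=> H; apply: ge_sup => [|_ [D fD <-]]; last exact: H.
by eexists; exists D0.
Qed.

Lemma max_noise_flip k A : `|f (flip k A) - f A| <= (1 - rho)^-1.
Proof.
have [rho0 rho1] := andP rho01.
(* One-sided control suffices, since it also applies to [flip k A] and flipping is an involution. *)
have H B : f (flip k B) <= f B + (1 - rho)^-1.
  apply: max_noise_le => D fD; apply: le_trans (noise_flip _ _ _ _ _ _ _) _ => //.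
    by move=> i j; exact: feasible_entry.
  by rewrite lerD2r le_max_noise.
have := H (flip k A); rewrite flipK; have := H A.
by rewrite ler_norml => h1 h2; apply/andP; split; lra.
Qed.

Lemma max_noise_sqr A : f A ^+ 2 <= 2 * t ^+ 2 * fdot (W A) (W A).
Proof.
have B0 : 0 <= 2 * t ^+ 2 * fdot (W A) (W A) by rewrite mulr_ge0 ?fdot_ge0 // mulr_ge0 ?sqr_ge0.
rewrite -[leRHS]sqr_sqrtr // ler_sqr ?nnegrE ?sqrtr_ge0 //.
  apply: max_noise_le => D fD; rewrite -[X in _ - X]D0M -mulmxBl -mulmxBr.
  rewrite fdot_mulr trmxK fdot_mull mulmxA (le_trans (ler_norm _)) // -sqrtr_sqr ler_wsqrtr //.
  apply: le_trans (fdot_cs _ _) _; rewrite ler_wpM2r ?fdot_ge0 //.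
  exact: (feasible_sub_fdot t Fu Fv).
(* The choice [D0] contributes 0, so [f A] is nonnegative, as comparing squares requires. *)
have := le_max_noise A _ fD0; rewrite D0M subrr.
by rewrite fdot0l.
Qed.

Lemma sqr_bern_E_max_noise : bern_E p f ^+ 2 <= 2 * t ^+ 2 * (d%:R ^+ 2 / (1 - rho)).
Proof.
apply: le_trans (sqr_bern_E_le p f p01) _.
have le_E : bern_E p (fun A => f A ^+ 2)
    <= bern_E p (fun A => 2 * t ^+ 2 * fdot (W A) (W A)).
  exact: ler_bern_E p01 max_noise_sqr.
rewrite (le_trans le_E) // bern_EZ (ler_wpM2l (mulr_ge0 (ler0n _ 2) (sqr_ge0 t))) //.
exact: compressed_noise_moment.
Qed.

End MaxNoise.

(** * Row norms, numerical constants and the final estimate *)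

Lemma orthonormal_cols_max_row_norm {R : realType} {m d : nat} (F : 'M[R]_(m, d)) :
  F^T *m F = 1%:M -> d%:R <= m%:R * max_row_norm F ^+ 2.
Proof.
(* The squared Frobenius norm is the trace of the identity of size [d] and also the sum of the
   squared row norms. *)
move=> FF; have <- : fdot F F = d%:R by rewrite /fdot FF mxtrace1.
have -> : m%:R * max_row_norm F ^+ 2 = \sum_(i < m) max_row_norm F ^+ 2.
  by rewrite sumr_const card_ord mulr_natl.
rewrite fdotE; apply: ler_sum => i _.
rewrite (eq_bigr (fun k => F i k ^+ 2)); last by move=> k _; rewrite expr2.
have -> : \sum_k F i k ^+ 2 = row_norm F i ^+ 2.
  by rewrite sqr_sqrtr // sumr_ge0 // => k _; exact: sqr_ge0.
have le_max : row_norm F i <= max_row_norm F by exact: le_bigmax.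
by rewrite ler_sqr ?nnegrE ?sqrtr_ge0 // (le_trans _ le_max) // sqrtr_ge0.
Qed.

Lemma max_row_norm_ge0 {R : realType} {m d : nat} (F : 'M[R]_(m, d)) : 0 <= max_row_norm F.
Proof. exact: bigmax_ge_id. Qed.

(** From [expR (- 2^-1) >= 1 - 2^-1] one gets [expR 2^-1 <= 2]. *)
Lemma ln2_ge_half {R : realType} : 2^-1 <= ln (2 : R).
Proof.
rewrite -ler_expR lnK ?posrE // (_ : 2^-1 = - (- 2^-1) :> R) ?opprK //.
rewrite -[2^-1 in leLHS]opprK expRN invf_ple ?posrE ?expR_gt0 //.
by apply: le_trans (expR_ge1Dx _); lra.
Qed.

Lemma mse_fdot {R : realType} {m n : nat} (M X : 'M[R]_(m, n)) :
  mse M X = (m * n)%:R^-1 * fdot (X - M) (X - M).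
Proof.
rewrite /mse fdotE; congr (_ * _); apply: eq_bigr => i _; apply: eq_bigr => j _.
by rewrite !mxE; ring.
Qed.

Theorem theorem6 (R : realType) (m n d : nat) (M : 'M[R]_(m, n))
  (Fu : 'M[R]_(m, d)) (Fv : 'M[R]_(n, d)) (t rho delta : R) :
  (0 < m)%N -> (0 < n)%N -> (0 < d)%N ->
  (forall i j, 0 <= M i j <= 1) ->
  nucnorm M <= t ->
  0 <= rho < 1 ->
  0 < delta < 1 ->
  Fu^T *m Fu = 1%:M ->
  Fv^T *m Fv = 1%:M ->
  M = Fu *m Fu^T *m M *m Fv *m Fv^T ->
  Prob rho M (fun A => forall Dhat, optimal rho t Fu Fv A Dhat ->
     mse M (Fu *m Dhat *m Fv^T) <=
       6 * Num.sqrt (ln (2 / delta)) / (Num.sqrt (m * n)%:R * (1 - rho))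
       + 4 * t * Num.sqrt (ln (2 * d%:R)) / (Num.sqrt (m * n)%:R * Num.sqrt (1 - rho))
         * max_row_norm Fu * max_row_norm Fv)
  >= 1 - delta.
Proof.
move=> m0 n0 d0 M01 Mt rho01 delta01 UU VV ME.
have [rho0 rho1] := andP rho01; have [del0 del1] := andP delta01.
have fD0 := feasible_compression _ _ _ _ M01 Mt UU VV ME.
have D0M : Fu *m (Fu^T *m M *m Fv) *m Fv^T = M by rewrite !mulmxA -ME.
have t0 : 0 <= t := le_trans (nucnorm_ge0 _ _ M) Mt.
set f := max_noise rho t M Fu Fv; set p := reveal_prob rho M.
have p01 x : 0 <= p x <= 1 by exact: reveal_prob_itv.
set N : R := (m * n)%:R; have N0 : 0 < N by rewrite ltr0n muln_gt0 m0.
set q := 1 - rho; have q0 : 0 < q by rewrite subr_gt0.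
have q1 : q <= 1 by rewrite gerBl.
set L := ln (2 / delta).
have L0 : 0 <= L by rewrite ln_ge0 // ler_pdivlMr // mul1r; lra.
set rL := Num.sqrt L; have rL0 : 0 <= rL by exact: sqrtr_ge0.
have rL2 : rL ^+ 2 = L by rewrite sqr_sqrtr.
set rN := Num.sqrt N; have rN0 : 0 < rN by rewrite sqrtr_gt0.
have rN2 : rN ^+ 2 = N by rewrite sqr_sqrtr // ltW.
set rq := Num.sqrt q; have rq0 : 0 < rq by rewrite sqrtr_gt0.
have rq2 : rq ^+ 2 = q by rewrite sqr_sqrtr // ltW.
have [N_ge0 q_ge0 rN_ge0 rq_ge0] := And4 (ltW N0) (ltW q0) (ltW rN0) (ltW rq0).
set Ld := ln (2 * d%:R); set rd := Num.sqrt Ld.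
have Ld_half : 2^-1 <= Ld.
  by rewrite (le_trans ln2_ge_half) // ler_ln ?posrE ?mulr_gt0 ?ltr0n // ler_peMr // ler1n.
have rd0 : 0 <= rd by exact: sqrtr_ge0.
have rd2 : rd ^+ 2 = Ld by rewrite sqr_sqrtr //; lra.
set Xu := max_row_norm Fu; set Xv := max_row_norm Fv.
have Xu0 : 0 <= Xu by exact: max_row_norm_ge0.
have Xv0 : 0 <= Xv by exact: max_row_norm_ge0.
have dX : d%:R ^+ 2 <= N * (Xu * Xv) ^+ 2.
  have -> : N * (Xu * Xv) ^+ 2 = (m%:R * Xu ^+ 2) * (n%:R * Xv ^+ 2).
    by rewrite /N natrM; ring.
  by rewrite expr2 ler_pM // orthonormal_cols_max_row_norm.
set b1 := 6 * rL / (rN * q); set b2 := 4 * t * rd / (rN * rq) * Xu * Xv.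
have b10 : 0 <= b1 by rewrite divr_ge0 ?mulr_ge0.
have b20 : 0 <= b2.
  by rewrite /b2 !(mulr_ge0, invr_ge0).
(* The halving matches the factor 2 of [optimal_noise]. After squaring, the claim reduces to [dX]
   and [1 <= 2 * Ld]. *)
have Ef : bern_E p f <= N * b2 / 2.
  have Nb20 : 0 <= N * b2 / 2 by rewrite (divr_ge0 (mulr_ge0 N_ge0 b20)).
  apply: le_trans (ler_norm _) _; rewrite -sqrtr_sqr -[leRHS]ger0_norm // -sqrtr_sqr.
  rewrite ler_wsqrtr //.
  apply: le_trans (sqr_bern_E_max_noise _ _ _ _ _ _ rho01 M01 UU VV fD0 D0M) _.
  have -> : (N * b2 / 2) ^+ 2 = 2 * t ^+ 2 * (2 * Ld * (N * (Xu * Xv) ^+ 2) / (1 - rho)).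
    rewrite -/q -rq2 -rd2 -rN2 /b2; field.
    by rewrite !gt_eqF.
  rewrite (ler_wpM2l (mulr_ge0 (ler0n _ 2) (sqr_ge0 t))) // ler_pM2r ?invr_gt0 //.
  apply: le_trans dX _; rewrite ler_peMl ?(mulr_ge0 N_ge0 (sqr_ge0 _)) //; lra.
apply: Prob_ge; rewrite -/p.
have [b1_ge1|b1_lt1] := leP 1 b1.
  rewrite big_pred0 ?ltW // => A; apply/negbTE; rewrite negbK; apply/asboolP => D [fD _].
  apply: le_trans (le_trans b1_ge1 _); last by rewrite lerDl.
  rewrite mse_fdot -/N mulrC ler_pdivrMr // mul1r.
  have -> : N = \sum_(i < m) \sum_(j < n) 1.
    by rewrite !sumr_const !card_ord -mulrnA mulnC.
  rewrite fdotE; apply: ler_sum => i _; apply: ler_sum => j _.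
  rewrite -expr2 -[leRHS]normr1 -real_normK ?num_real // normr1.
  by rewrite expr_le1 // (feasible_entry t _ _ _ M01).
(* The deviation [s] is [N * b1 / 2], and [l] minimizes the tail exponent
   [2 * (l / q) ^+ 2 * N - l * s], whose minimum is [- (9 / 8 * L)]. *)
pose s := 3 * rN * rL / q; pose l := 3 * rL * q / (4 * rN).
have sE : N * b1 / 2 = s by rewrite /b1 /s -rN2; field; rewrite !gt_eqF.
have lc : l * q^-1 = 3 / 4 * (rL / rN) by rewrite /l; field; rewrite !gt_eqF.
have lc_half : l * q^-1 <= 2^-1.
  (* This is where [b1 < 1] enters: [6 * rL < rN * q <= rN]. *)
  rewrite lc; have : rL / rN <= 1 / 6.
    rewrite ler_pdivrMr //; move: b1_lt1; rewrite ltr_pdivrMr ?mulr_gt0 // mul1r.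
    have : rN * q <= rN by rewrite ler_piMr.
    by lra.
  by lra.
have l0 : 0 <= l by rewrite divr_ge0 ?mulr_ge0.
apply: (@le_trans _ _ (expR (2 * (l * q^-1) ^+ 2 * #|{: 'I_m * 'I_n}|%:R - l * s))).
  apply: (bounded_differences_tail p q^-1 l s f) => //.
    by move=> k A; apply: (max_noise_flip _ _ _ _ _ _ rho01 M01 fD0).
  (* If the estimate fails for some optimal [D], then [2 * f A >= N * mse > 2 * s + N * b2], and
     [Ef] turns this into a deviation of at least [s]. *)
  move=> A /asboolPn /existsNP [D /not_implyP [optD /negP]].
  rewrite -ltNge -/b1 -/b2 => mse_gt.
  have := optimal_noise _ _ _ _ _ _ _ _ rho1 fD0 D0M optD.
  have fA := le_max_noise rho t _ Fu Fv M01 A D (proj1 optD).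
  move: mse_gt; rewrite mse_fdot -/N -(ltr_pM2l N0) mulrA mulfV ?gt_eqF // mul1r.
  by rewrite mulrDr -sE -/f in fA * => h1 /= h2; lra.
rewrite card_prod !card_ord -/N lc.
have -> : 2 * (3 / 4 * (rL / rN)) ^+ 2 * N - l * s = - (9 / 8 * L).
  by rewrite /l /s -rN2 -rL2; field; rewrite !gt_eqF.
(* By the definition of [L], [expR (- L)] is [delta / 2], below [delta]. *)
apply: (@le_trans _ _ (expR (- L))); first by rewrite ler_expR; lra.
rewrite expRN lnK ?posrE ?divr_gt0 // invf_div.
by lra.
Qed.
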